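(* For a sample of size $N=1$, the average sufficient statistic $\bar n_S^*$ never lies in the interior of the polytope $$\mathcal{P}_n=\operatorname{conv}\{n_S^*(g) : g\in\mathcal{G}_n\}\subset\mathbb{R}^{n-1};$$ that is, the maximum likelihood estimator (of the natural parameter $\theta\in\mathbb{R}^{n-1}$ of the shell distribution exponential random graph model with unrestricted degeneracy) never exists.
   Context: $\mathcal{G}_n$ is the set of all simple graphs on $n$ (labeled) nodes. The $k$-core $H_k(g)$ of a graph $g$ is the maximal subgraph of $g$ in which every vertex has degree at least $k$ (possibly empty). A vertex $v$ has shell index $i$ if $v\in H_i(g)$ but $v\notin H_{i+1}(g)$. For $0\le j\le n-1$, $n_j(g)$ is the number of vertices of $g$ with shell index $j$. The truncated shell distribution of $g$ is $n_S^*(g)=(n_0(g),\ldots,n_{n-2}(g))$. For a sample $g_1,\ldots,g_N$ of graphs in $\mathcal{G}_n$, the average sufficient statistic is $\bar n_S^*=\frac1N\sum_{i=1}^N n_S^*(g_i)$; for $N=1$ it is $n_S^*(g_1)$. The shell distribution exponential random graph model with unrestricted degeneracy is the family of probability distributions on $\mathcal{G}_n$ given by $$P_\theta(G=g)=\exp\Big\{\sum_{j=0}^{n-2}n_j(g)\theta_j-\psi(\theta)\Big\},\qquad \psi(\theta)=\log\sum_{h\in\mathcal{G}_n}\exp\Big\{\sum_{j=0}^{n-2}n_j(h)\theta_j\Big\},$$ with natural parameter $\theta=(\theta_0,\ldots,\theta_{n-2})\in\mathbb{R}^{n-1}$ and minimal sufficient statistic $n_S^*(g)$. The maximum likelihood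 estimator for a single observed graph $g$ exists if $\theta\mapsto P_\theta(G=g)$ attains its maximum over $\mathbb{R}^{n-1}$. *)

(* Defs.v *)
From HB Require Import structures.
From mathcomp Require Import all_boot all_order all_algebra.

Set Implicit Arguments.
Unset Strict Implicit.
Unset Printing Implicit Defensive.

Record sgraph (n : nat) := SGraph {
  edges : {set {set 'I_n}};
  edgesP : [forall e in edges, #|e| == 2]
}.

HB.instance Definition _ n := [isSub for @edges n].
HB.instance Definition _ n := [Finite of sgraph n by <:].

Section KCore.
Variable n : nat.

(* (V, E); only the pairs satisfying [is_subgraph g] are subgraphs of g, and
   these need not be induced *)
Definition subgraph : Type := ({set 'I_n} * {set {set 'I_n}})%type.

Definition is_subgraph (g : sgraph n) (H : subgraph) : bool :=
  (H.2 \subset edges g) && [forall e in H.2, e \subset H.1].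

Definition subgraph_le (H K : subgraph) : bool :=
  (H.1 \subset K.1) && (H.2 \subset K.2).

Definition sdegree (H : subgraph) (v : 'I_n) : nat :=
  #|[set e in H.2 | v \in e]|.

Definition mindeg_subgraph (k : nat) (g : sgraph n) (H : subgraph) : bool :=
  is_subgraph g H && [forall v in H.1, k <= sdegree H v].

Definition is_kcore (k : nat) (g : sgraph n) (H : subgraph) : bool :=
  mindeg_subgraph k g H &&
  [forall K : subgraph, mindeg_subgraph k g K && subgraph_le H K ==> (K == H)].

(* The default value is never used and the choice is unique: see [kcoreP]
   and [kcore_uniq]. *)
Definition kcore (k : nat) (g : sgraph n) : subgraph :=
  odflt (set0, set0) [pick H : subgraph | is_kcore k g H].

Definition has_shell_index (g : sgraph n) (i : nat) (v : 'I_n) : bool :=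
  (v \in (kcore i g).1) && (v \notin (kcore i.+1 g).1).

Definition nshell (g : sgraph n) (j : nat) : nat :=
  #|[set v | has_shell_index g j v]|.

Lemma mindeg_subgraphU k g H K : mindeg_subgraph k g H ->
  mindeg_subgraph k g K -> mindeg_subgraph k g (H.1 :|: K.1, H.2 :|: K.2).
Proof.
move=> /andP[/andP[Hg /forall_inP HV] /forall_inP Hd].
move=> /andP[/andP[Kg /forall_inP KV] /forall_inP Kd].
apply/andP; split.
  rewrite /is_subgraph /= subUset Hg Kg /=; apply/forall_inP => e.
  rewrite inE => /orP[/HV|/KV] eS; apply: (subset_trans eS).
    exact: subsetUl.
  exact: subsetUr.
apply/forall_inP => v /=; rewrite inE => /orP[/Hd|/Kd] kv;
  apply: (leq_trans kv); apply/subset_leq_card/subsetP => e;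
  rewrite !inE => /andP[-> ->]; by rewrite ?orbT.
Qed.

Lemma kcoreP k g : is_kcore k g (kcore k g).
Proof.
rewrite /kcore; case: pickP => [//|no].
have m0 : mindeg_subgraph k g (set0, set0).
  by rewrite /mindeg_subgraph /is_subgraph sub0set /=;
     apply/andP; split; apply/forall_inP => x; rewrite inE.
pose m (H : subgraph) := #|H.1| + #|H.2|.
case: (@arg_maxnP _ (set0, set0) (mindeg_subgraph k g) m m0).
move=> H mH Hmax; have := no H; rewrite /is_kcore mH /= => /negP[].
apply/forallP => K; apply/implyP => /andP[mK /andP[H1 H2]].
have le := Hmax _ mK.
have l1 := subset_leq_card H1; have l2 := subset_leq_card H2.
have e1 : #|K.1| <= #|H.1|.
  by rewrite -(leq_add2r #|K.2|); apply: (leq_trans le); rewrite leq_add2l.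
have e2 : #|K.2| <= #|H.2|.
  by rewrite -(leq_add2l #|K.1|); apply: (leq_trans le); rewrite leq_add2r.
have E1 : H.1 = K.1 by apply/eqP; rewrite eqEcard H1.
have E2 : H.2 = K.2 by apply/eqP; rewrite eqEcard H2.
by rewrite [H]surjective_pairing [K]surjective_pairing E1 E2.
Qed.

Lemma is_kcore_max k g H K :
  is_kcore k g H -> mindeg_subgraph k g K -> subgraph_le K H.
Proof.
move=> /andP[mH /forallP Hmax] mK.
have /implyP := Hmax (H.1 :|: K.1, H.2 :|: K.2).
rewrite mindeg_subgraphU // /subgraph_le /= !subsetUl => /(_ isT)/eqP E.
by rewrite -[H]E /= !subsetUr.
Qed.

Lemma kcore_uniq k g H : is_kcore k g H -> H = kcore k g.
Proof.
move=> kH; have /andP[_ /forallP/(_ (kcore k g))/implyP Hmax] := kH.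
have /andP[mc _] := kcoreP k g.
by apply/esym/eqP/Hmax; rewrite mc (is_kcore_max (kcoreP k g)) //; case/andP: kH.
Qed.

End KCore.

From mathcomp Require Import all_classical all_reals all_analysis.

Import Order.TTheory GRing.Theory Num.Theory.
Import numFieldNormedType.Exports.

Local Open Scope classical_set_scope.
Local Open Scope ring_scope.

Section Ergm.
Variables (R : realType) (n : nat).

Definition shell_stat (g : sgraph n) : 'rV[R]_(n.-1) :=
  \row_(j < n.-1) (nshell g j)%:R.

Definition avg_shell_stat (N : nat) (s : 'I_N -> sgraph n) : 'rV[R]_(n.-1) :=
  N%:R^-1 *: \sum_(i < N) shell_stat (s i).

Definition convex_hull (m : nat) (A : set 'rV[R]_m) : set 'rV[R]_m :=
  smallest (@convex_set R 'rV[R]_m) A.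

Definition shell_polytope : set 'rV[R]_(n.-1) :=
  convex_hull [set shell_stat g | g in [set: sgraph n]].

Definition energy (theta : 'rV[R]_(n.-1)) (g : sgraph n) : R :=
  \sum_(j < n.-1) (nshell g j)%:R * theta ord0 j.

Definition psi (theta : 'rV[R]_(n.-1)) : R :=
  ln (\sum_(h : sgraph n) expR (energy theta h)).

Definition shell_ergm (theta : 'rV[R]_(n.-1)) (g : sgraph n) : R :=
  expR (energy theta g - psi theta).

Definition mle_exists (g : sgraph n) : Prop :=
  exists theta : 'rV[R]_(n.-1),
    forall theta' : 'rV[R]_(n.-1), shell_ergm theta' g <= shell_ergm theta g.

End Ergm.

Arguments shell_polytope R n : clear implicits.

(* Main.v *)
Require Import Defs.
From HB Require Import structures.
From mathcomp Require Import all_boot all_order all_algebra.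

(** The key fact is that all truncated shell distributions lie on two parallel
    hyperplanes, and that the polytope is contained in the slab between them.

    Let T(g) be the sum of n_j(g) for 0 <= j <= n - 2. The cores of g are nested
    and the 0-core is the whole vertex set, so the sum telescopes to
    T(g) = n - |C|, where C is the vertex set of the (n-1)-core
    ([sum_nshell]). A nonempty k-core has more than k vertices
    ([kcore_card_gt]), so C is empty or everything, and T(g) is n or 0
    ([sum_nshell_dichotomy]). Both values occur: the empty graph has T = n (as
    n >= 2), and the complete graph has T = 0.

    Hence, for every graph g, one of the functionals T and -T is maximal at the
    statistic of g without being constant on all graphs
    ([shell_stat_supported]). A nonconstant linear functional that is maximal
    over the polytope at a point excludes this point from the interior
    ([exposed_not_interior]). It also prevents the likelihood of g from
    attaining its maximum, since translating the parameter in the direction of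
    the functional always increases the likelihood strictly
    ([recession_not_mle]). *)

Set Implicit Arguments.
Unset Strict Implicit.
Unset Printing Implicit Defensive.

Lemma sdegree_lt n (g : sgraph n) (H : subgraph n) (v : 'I_n) :
  is_subgraph g H -> v \in H.1 -> sdegree H v < #|H.1|.
Proof.
move=> /andP[Hg /forall_inP HV] vH.
(* Every edge at v has the form {v, u} with u another vertex of H. *)
have sub : [set e in H.2 | v \in e] \subset
    [set [set v; u] | u in H.1 :\ v].
  apply/subsetP => e; rewrite inE => /andP[eH ve].
  have /forall_inP/(_ e (subsetP Hg e eH)) := edgesP g.
  move=> /cards2P[a [b [ab eE]]]; have eV := subsetP (HV e eH).
  apply/imsetP; move: ve; rewrite eE !inE => /orP[]/eqP->.
    by exists b => //; rewrite !inE eq_sym ab eV // eE !inE eqxx orbT.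
  by exists a; rewrite ?(setUC [set b]) // !inE ab eV // eE !inE eqxx.
rewrite (cardsD1 v H.1) vH ltnS.
exact: leq_trans (subset_leq_card sub) (leq_imset_card _ _).
Qed.

Lemma kcore_mindeg n k (g : sgraph n) : mindeg_subgraph k g (kcore k g).
Proof. by case/andP: (kcoreP k g). Qed.

Lemma mindeg_sub_kcore n k (g : sgraph n) (H : subgraph n) :
  mindeg_subgraph k g H -> H.1 \subset (kcore k g).1.
Proof. by move=> /(is_kcore_max (kcoreP k g))/andP[]. Qed.

Lemma kcore_card_gt n k (g : sgraph n) v :
  v \in (kcore k g).1 -> k < #|(kcore k g).1|.
Proof.
move=> vH; have /andP[Hg /forall_inP/(_ v vH) kv] := kcore_mindeg k g.
exact: leq_ltn_trans kv (sdegree_lt Hg vH).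
Qed.

Lemma kcore0 n (g : sgraph n) : (kcore 0 g).1 = [set: 'I_n].
Proof.
apply/eqP; rewrite -subTset.
apply: (@mindeg_sub_kcore _ _ _ ([set: 'I_n], set0)).
by rewrite /mindeg_subgraph /is_subgraph /= sub0set /=; apply/andP; split;
  apply/forall_inP => x; rewrite // inE.
Qed.

Lemma kcore_sub n k (g : sgraph n) : (kcore k.+1 g).1 \subset (kcore k g).1.
Proof.
apply: mindeg_sub_kcore; have /andP[Hg /forall_inP Hd] := kcore_mindeg k.+1 g.
by apply/andP; split=> //; apply/forall_inP => v /Hd/ltnW.
Qed.

Lemma nshell_kcore n (g : sgraph n) j :
  nshell g j = #|(kcore j g).1| - #|(kcore j.+1 g).1|.
Proof.
rewrite -(setIidPr (kcore_sub j g)) -cardsD; apply: eq_card => v.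
by rewrite !inE andbC.
Qed.

(** The cores decrease from the whole vertex set, and the j-th shell is the
    difference of two consecutive cores, so the sum telescopes. *)
Lemma sum_nshell n (g : sgraph n) k :
  \sum_(j < k) nshell g j + #|(kcore k g).1| = n.
Proof.
elim: k => [|k IHk]; first by rewrite big_ord0 kcore0 cardsT card_ord.
rewrite big_ord_recr /= nshell_kcore -addnA subnK //.
exact: subset_leq_card (kcore_sub k g).
Qed.

(** The coordinates of the truncated shell distribution add up to n minus the
    order of the (n-1)-core, which is either empty or has all n vertices. *)
Lemma sum_nshell_dichotomy n (g : sgraph n) :
  \sum_(j < n.-1) nshell g j = 0 \/ \sum_(j < n.-1) nshell g j = n.
Proof.
have E := sum_nshell g n.-1.
have [C0|[v /kcore_card_gt nC]] := set_0Vmem (kcore n.-1 g).1.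
  by right; rewrite C0 cards0 addn0 in E.
have {}nC : n <= #|(kcore n.-1 g).1| := leq_trans (leqSpred n) nC.
by left; apply/eqP; rewrite -leqn0 -(leq_add2r #|(kcore n.-1 g).1|) E add0n.
Qed.

Lemma empty_graph_proof n : [forall e in (set0 : {set {set 'I_n}}), #|e| == 2].
Proof. by apply/forall_inP => e; rewrite inE. Qed.

(** The graph on n vertices without edges. *)
Definition empty_graph n : sgraph n := SGraph (empty_graph_proof n).

Lemma complete_graph_proof n :
  [forall e in [set e : {set 'I_n} | #|e| == 2], #|e| == 2].
Proof. by apply/forall_inP => e; rewrite inE. Qed.

(** The graph whose edges are all pairs of distinct vertices. *)
Definition complete_graph n : sgraph n := SGraph (complete_graph_proof n).

Lemma sum_nshell_empty n : 1 < n ->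
  \sum_(j < n.-1) nshell (empty_graph n) j = n.
Proof.
move=> n1; rewrite -[RHS](sum_nshell (empty_graph n) n.-1).
have [->|[v vC]] := set_0Vmem (kcore n.-1 (empty_graph n)).1.
  by rewrite cards0 addn0.
have /andP[/andP[E0 _] /forall_inP/(_ v vC)] :=
  kcore_mindeg n.-1 (empty_graph n).
(* The degree in the core would be 0, yet at least n - 1 > 0. *)
suff -> : sdegree (kcore n.-1 (empty_graph n)) v = 0 by case: (n) n1 => [|[]].
apply/eqP; rewrite cards_eq0 -subset0; apply/subsetP => e.
by rewrite inE => /andP[/(subsetP E0)]; rewrite inE.
Qed.

Lemma sum_nshell_complete n :
  \sum_(j < n.-1) nshell (complete_graph n) j = 0.
Proof.
suff CT : [set: 'I_n] \subset (kcore n.-1 (complete_graph n)).1.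
  have := sum_nshell (complete_graph n) n.-1.
  rewrite (eqP (_ : _.1 == [set: 'I_n])) -?subTset // cardsT card_ord.
  by move/(canRL (addnK _)); rewrite subnn.
apply: (@mindeg_sub_kcore _ _ _ ([set: 'I_n], edges (complete_graph n))).
rewrite /mindeg_subgraph /is_subgraph subxx /=; apply/andP; split.
  by apply/forall_inP => e _; exact: subsetT.
apply/forall_inP => v _; rewrite -[n in n.-1]card_ord -cardsT.
rewrite (cardsD1 v) inE /= -(@card_in_imset _ _ (fun u => [set v; u])).
  apply/subset_leq_card/subsetP => e /imsetP[u]; rewrite !inE andbT => uv ->.
  by rewrite set21 cards2 (eq_sym v) uv.
move=> u w; rewrite !inE !andbT => uv wv /setP/(_ u).
by rewrite !inE eqxx orbT (negbTE uv) => /esym/eqP.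
Qed.

From mathcomp Require Import all_classical all_reals all_analysis.

Import Order.TTheory GRing.Theory Num.Theory.
Import numFieldNormedType.Exports.

Local Open Scope classical_set_scope.
Local Open Scope ring_scope.

Lemma convex_halfspace (R : realType) m (c : 'cV[R]_m) (b : R) :
  convex_set [set x : 'rV[R]_m | (x *m c) ord0 ord0 <= b].
Proof.
move=> x y l; rewrite !inE /= => xb yb; rewrite mulmxDl -!scalemxAl.
move: xb yb; rewrite !mxE => xb yb.
have -> : b = l%:num * b + (1 - l%:num) * b by rewrite -mulrDl subrKC mul1r.
by rewrite lerD // ler_wpM2l ?subr_ge0.
Qed.

Lemma convex_hull_halfspace (R : realType) m (A : set 'rV[R]_m) (c : 'cV[R]_m)
    (b : R) : (forall a, A a -> (a *m c) ord0 ord0 <= b) ->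
  forall x, convex_hull A x -> (x *m c) ord0 ord0 <= b.
Proof.
by move=> Ab x; apply: (smallest_sub (@convex_halfspace R m c b)) => y /Ab.
Qed.

(** A bound of a linear functional on A extends to the convex hull of A, and a
    nonzero linear functional has no maximum in the interior of a set. *)
Lemma exposed_not_interior (R : realType) m (A : set 'rV[R]_m) (c : 'cV[R]_m)
    (x : 'rV[R]_m) : c != 0 ->
  (forall a, A a -> (a *m c) ord0 ord0 <= (x *m c) ord0 ord0) ->
  ~ interior (convex_hull A) x.
Proof.
move=> c0 Ax xint.
(* A point of the hull slightly away from x in the direction c would have a
   larger value of the functional than x. *)
have lin : (fun t : R => x + t *: c^T) @ (0 : R) --> x.
  rewrite -[X in _ --> X]addr0 -[X in _ + X](scale0r c^T).
  apply: cvgD; first exact: cvg_cst.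
  by apply: cvgZr_tmp; exact: cvg_id.
have [e /= e0 eA] : \forall t \near (0 : R), convex_hull A (x + t *: c^T).
  exact: lin xint.
have : convex_hull A (x + (e / 2) *: c^T).
  apply: eA; rewrite /= sub0r normrN gtr0_norm ?divr_gt0 //.
  by rewrite ltr_pdivrMr // mulr_natr mulr2n ltrDl.
move/(convex_hull_halfspace Ax); rewrite mulmxDl -scalemxAl !mxE gerDl.
apply/negP; rewrite -ltNge mulr_gt0 ?divr_gt0 //.
have [i ci] : exists i, c i ord0 != 0.
  apply/existsP; apply: contraNT c0 => /existsPn ci.
  apply/eqP/matrixP => i j; rewrite ord1 mxE; exact/eqP/negPn/ci.
rewrite (bigD1 i) //= mxE ltr_pwDl // ?sumr_ge0 // => [|j _].
  by rewrite -expr2 exprn_even_gt0.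
by rewrite mxE -expr2 sqr_ge0.
Qed.

Lemma sum_expR_gt0 (R : realType) n (theta : 'rV[R]_n.-1) :
  0 < \sum_(h : sgraph n) expR (energy theta h).
Proof.
by rewrite (bigD1 (empty_graph n)) //= ltr_pwDl ?expR_gt0 ?sumr_ge0.
Qed.

Lemma energyD (R : realType) n (theta c : 'rV[R]_n.-1) (g : sgraph n) :
  energy (theta + c) g = energy theta g + energy c g.
Proof. by rewrite -big_split; apply: eq_bigr => j _; rewrite mxE mulrDr. Qed.

(** If a direction c is maximal at the statistic of g, and not constant on all
    graphs, then moving any parameter by c strictly increases the likelihood
    of g: every weight in the normalizing sum grows at most by the factor
    exp (energy c g), and one of them grows by less. *)
Lemma recession_not_mle (R : realType) n (g : sgraph n) (c : 'rV[R]_n.-1) :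
  (forall h, energy c h <= energy c g) -> (exists h, energy c h < energy c g) ->
  ~ mle_exists R g.
Proof.
move=> cg [h ch] [theta /(_ (theta + c))]; apply/negP; rewrite -ltNge ltr_expR.
(* The log-likelihood of g changes by energy c g minus the growth of psi. *)
suff psic : psi (theta + c) < psi theta + energy c g.
  by rewrite energyD -addrA ltrD2l ltrBrDl ltrBlDl.
rewrite -[energy c g]expRK -lnM ?posrE ?sum_expR_gt0 ?expR_gt0 //.
rewrite ltr_ln ?posrE ?mulr_gt0 ?sum_expR_gt0 ?expR_gt0 //.
rewrite mulr_suml (bigD1 h) //= [ltRHS](bigD1 h) //=.
apply: ltr_leD; first by rewrite energyD expRD ltr_pM2l ?expR_gt0 // ltr_expR.
by apply: ler_sum => h' _; rewrite energyD expRD ler_pM2l ?expR_gt0 // ler_expR.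
Qed.

Lemma energy_const (R : realType) n (t : R) (g : sgraph n) :
  energy (const_mx t) g = (\sum_(j < n.-1) nshell g j)%:R * t.
Proof. by rewrite natr_sum mulr_suml; apply: eq_bigr => j _; rewrite mxE. Qed.

Lemma energyE (R : realType) n (c : 'rV[R]_n.-1) (g : sgraph n) :
  energy c g = (shell_stat R g *m c^T) ord0 ord0.
Proof. by rewrite mxE; apply: eq_bigr => j _; rewrite !mxE. Qed.

Lemma avg_shell_stat1 (R : realType) n (s : 'I_1 -> sgraph n) :
  avg_shell_stat R s = shell_stat R (s ord0).
Proof. by rewrite /avg_shell_stat big_ord1 invr1 scale1r. Qed.

(** The supporting functional is the sum of the coordinates when that sum is n,
    and its opposite when that sum is 0. *)
Lemma shell_stat_supported (R : realType) n (g : sgraph n) : (1 < n)%N ->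
  exists2 c : 'rV[R]_n.-1, forall h, energy c h <= energy c g &
    exists h, energy c h < energy c g.
Proof.
move=> n1; have n0 : 0 < n%:R :> R by rewrite ltr0n ltnW.
have [Tg|Tg] := sum_nshell_dichotomy g.
  exists (const_mx (-1)); last exists (empty_graph n).
    by move=> h; rewrite !energy_const Tg mul0r mulrN1 oppr_le0.
  by rewrite !energy_const Tg sum_nshell_empty // mul0r mulrN1 oppr_lt0.
exists (const_mx 1); last exists (complete_graph n).
  move=> h; rewrite !energy_const Tg !mulr1.
  by have [->|->] := sum_nshell_dichotomy h; rewrite ?ler_nat.
by rewrite !energy_const Tg sum_nshell_complete mul0r mulr1.
Qed.

Theorem proposition17 (R : realType) (n : nat) (hn : (2 <= n)%N)
    (s : 'I_1 -> sgraph n) :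
  ~ interior (shell_polytope R n) (avg_shell_stat R s) /\
  ~ mle_exists R (s ord0).
Proof.
have [c cmax clt] := shell_stat_supported R (s ord0) hn.
split; last exact: recession_not_mle cmax clt.
rewrite avg_shell_stat1; apply: (@exposed_not_interior _ _ _ c^T).
  have [h] := clt; apply: contraTneq => c0.
  by rewrite !energyE c0 !mulmx0 ltxx.
by move=> _ [h _ <-]; rewrite -!energyE.
Qed.
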